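(* Let $k\ge 2$ and let $x_1,\ldots,x_k,y_1,\ldots,y_k$ be real numbers. For each nonempty $I\subseteq\{2,\ldots,k\}$ put $x_I=x_1+\sum_{i\in I}x_i$ and $y_I=y_1+\sum_{i\in I}y_i$, and let $\{i_1,\ldots,i_r\}=\{2,\ldots,k\}\setminus I$, where $r=k-1-|I|$. Then $$\phi(x_1,y_1,x_2,y_2,\ldots,x_k,y_k)=\sum_{\emptyset\ne I\subseteq \{2,\ldots,k\}}\left((-1)^{|I|-1}\left(\prod_{j\in I}(x_1y_j+x_jy_1)\right)\phi(x_I,y_I,x_{i_1},y_{i_1},\ldots,x_{i_r},y_{i_r})\right).$$
   Context: For every $\ell\ge 1$, $\phi$ is the function of $2\ell$ variables $x_1,y_1,\ldots,x_\ell,y_\ell$ given by $$\phi(x_1,y_1,\ldots,x_\ell,y_\ell)=\frac{1}{XY}\left(\prod_{i=1}^\ell(x_iY+y_iX)\right)\left(1-\sum_{i=1}^\ell\frac{x_iy_i}{x_iY+y_iX}\right)=\frac{1}{XY}\left(\prod_{i=1}^\ell(x_iY+y_iX)-\sum_{i=1}^\ell x_iy_i\prod_{j\ne i}(x_jY+y_jX)\right),$$ where $X=x_1+\cdots+x_\ell$ and $Y=y_1+\cdots+y_\ell$. This expression is a polynomial in the $2\ell$ variables (e.g. $\phi(x_1,y_1)=1$, $\phi(x_1,y_1,x_2,y_2)=x_1y_2+x_2y_1$), and for real arguments $\phi$ denotes the value of this polynomial. *)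

(* Defs.v *)
From HB Require Import structures.
From mathcomp Require Import all_boot all_order all_algebra.
From mathcomp Require Import reals.
From mathcomp Require Import mpoly.
From mathcomp Require Import ring.

Set Implicit Arguments.
Unset Strict Implicit.
Unset Printing Implicit Defensive.

Import GRing.Theory.
Local Open Scope ring_scope.

Section PhiFraction.
Variables (R : realType) (l : nat).

(* The first l of the 2l indeterminates are the x_i, the last l the y_i. *)
Definition phi_x (i : 'I_l) : {mpoly R[l + l]} := 'X_(lshift l i).
Definition phi_y (i : 'I_l) : {mpoly R[l + l]} := 'X_(rshift l i).
Definition phi_X : {mpoly R[l + l]} := \sum_(i < l) phi_x i.
Definition phi_Y : {mpoly R[l + l]} := \sum_(i < l) phi_y i.

Definition phi_num : {mpoly R[l + l]} :=
  \prod_(i < l) (phi_x i * phi_Y + phi_y i * phi_X)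
  - \sum_(i < l) phi_x i * phi_y i *
      \prod_(j < l | j != i) (phi_x j * phi_Y + phi_y j * phi_X).

Definition phi_frac : {fraction {mpoly R[l + l]}} :=
  tofrac phi_num / tofrac (phi_X * phi_Y).

End PhiFraction.

Lemma phi_prod_expand (A : comNzRingType) (I : eqType) (a b : I -> A)
    (u v : A) (s : seq I) : (0 < size s)%N ->
  exists q, \prod_(i <- s) (a i * v + b i * u) =
    v ^+ size s * \prod_(i <- s) a i + u ^+ size s * \prod_(i <- s) b i
    + u * v * q.
Proof.
elim: s => // i s IHs _; case: s IHs => [_|j s /(_ isT) [q Hq]].
  by exists 0; rewrite !big_cons !big_nil /=; ring.
rewrite !(big_cons _ _ i) Hq.
set P := \prod_(k <- _) a k; set Q := \prod_(k <- _) b k.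
exists (a i * u ^+ size s * Q + b i * v ^+ size s * P
        + (a i * v + b i * u) * q).
by rewrite /= !exprS; ring.
Qed.

Lemma phi_prodC_expand (A : comNzRingType) n (a b : 'I_n -> A) (u v : A)
    (P : pred 'I_n) : (0 < #|P|)%N ->
  exists q, \prod_(i | P i) (a i * v + b i * u) =
    v ^+ #|P| * \prod_(i | P i) a i + u ^+ #|P| * \prod_(i | P i) b i
    + u * v * q.
Proof.
move=> P_gt0; rewrite -!big_enum cardE /=.
by apply: phi_prod_expand; rewrite -cardE.
Qed.

Lemma phi_num_dvd (A : comNzRingType) l (a b : 'I_l -> A) : (0 < l)%N ->
  let u := \sum_i a i in let v := \sum_i b i in
  exists p : A, \prod_i (a i * v + b i * u)
    - \sum_i a i * b i * \prod_(j | j != i) (a j * v + b j * u) = u * v * p.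
Proof.
case: l a b => // -[|l] a b _ u v.
  exists 1; rewrite /u /v !big_ord_recl !big_ord0 big1 => [|j]; first by ring.
  by rewrite (ord1 j).
have [Eu Ev] : u = \sum_i a i /\ v = \sum_i b i by [].
clearbody u v.
have cardT1 : #|xpredT : pred 'I_l.+2| = l.+2.
  by rewrite -[RHS]card_ord; apply: eq_card.
have [|q Hq] := @phi_prodC_expand A l.+2 a b u v xpredT; first by rewrite cardT1.
have cardC1i (i : 'I_l.+2) : #|[pred j | j != i]| = l.+1.
  by rewrite -[RHS]/(l.+2.-1) -[X in X.-1](card_ord l.+2) -(cardC1 i);
    apply: eq_card.
have Hi (i : 'I_l.+2) : exists r, \prod_(j | j != i) (a j * v + b j * u) =
    v ^+ l.+1 * \prod_(j | j != i) a j + u ^+ l.+1 * \prod_(j | j != i) b j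
    + u * v * r.
  have := @phi_prodC_expand A l.+2 a b u v [pred j | j != i].
  by rewrite cardC1i; apply.
have [r Hr] := fin_all_exists Hi.
exists (q - \sum_i a i * b i * r i); rewrite Hq cardT1.
suff -> : \sum_i a i * b i * \prod_(j | j != i) (a j * v + b j * u) =
    v ^+ l.+1 * (\prod_j a j) * (\sum_i b i)
    + u ^+ l.+1 * (\prod_j b j) * (\sum_i a i)
    + u * v * (\sum_i a i * b i * r i).
  by rewrite -Eu -Ev !exprS; ring.
rewrite !mulr_sumr -!big_split /=; apply: eq_bigr => i _.
by rewrite Hr [\prod_j a j](bigD1 i) //= [\prod_j b j](bigD1 i) //=; ring.
Qed.

Section PhiPoly.
Variable R : realType.

Let mpoly_ones_neq0 n (p : {mpoly R[n]}) : p.@[fun=> 1] != 0 -> p != 0.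
Proof. by apply: contraNneq => ->; rewrite meval0. Qed.

Lemma phi_X_neq0 l : (0 < l)%N -> phi_X R l != 0.
Proof.
move=> l_gt0; apply: mpoly_ones_neq0; rewrite /phi_X raddf_sum /=.
under eq_bigr => i _ do rewrite mevalXU.
by rewrite sumr_const card_ord Num.Theory.pnatr_eq0 -lt0n.
Qed.

Lemma phi_Y_neq0 l : (0 < l)%N -> phi_Y R l != 0.
Proof.
move=> l_gt0; apply: mpoly_ones_neq0; rewrite /phi_Y raddf_sum /=.
under eq_bigr => i _ do rewrite mevalXU.
by rewrite sumr_const card_ord Num.Theory.pnatr_eq0 -lt0n.
Qed.

(* For l = 0 the fraction is 1 / 0 = 0 by the convention on inverses. *)
Lemma phi_frac_poly l : exists p : {mpoly R[l + l]}, tofrac p == phi_frac R l.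
Proof.
case: (posnP l) => [-> | l_gt0].
  by exists 0; rewrite /phi_frac /phi_X big_ord0 mul0r tofrac0 invr0 mulr0.
have [p Hp] := phi_num_dvd (@phi_x R l) (@phi_y R l) l_gt0.
exists p; rewrite /phi_frac /phi_num Hp [tofrac (_ * p)]tofracM mulrAC divff ?mul1r //.
by rewrite tofrac_eq0 mulf_neq0 ?phi_X_neq0 ?phi_Y_neq0.
Qed.

Definition phi_poly l : {mpoly R[l + l]} := xchoose (phi_frac_poly l).

Lemma phi_poly_frac l : tofrac (phi_poly l) = phi_frac R l.
Proof. exact/eqP/(xchooseP (phi_frac_poly l)). Qed.

Lemma phi_polyE l : (0 < l)%N ->
  phi_X R l * phi_Y R l * phi_poly l = phi_num R l.
Proof.
move=> l_gt0; apply/eqP; rewrite -tofrac_eq tofracM phi_poly_frac mulrC.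
by rewrite divfK // tofrac_eq0 mulf_neq0 ?phi_X_neq0 ?phi_Y_neq0.
Qed.

(* phi [:: (x_1, y_1); ...; (x_l, y_l)] is phi(x_1, y_1, ..., x_l, y_l). *)
Definition phi (s : seq (R * R)) : R :=
  (phi_poly (size s)).@[fun i => match split i with
                                 | inl j => (tnth (in_tuple s) j).1
                                 | inr j => (tnth (in_tuple s) j).2
                                 end].

Lemma phi1 x1 y1 : phi [:: (x1, y1)] = 1.
Proof.
rewrite /phi /= (_ : phi_poly 1 = 1) ?meval1 //.
apply: (mulfI (mulf_neq0 (@phi_X_neq0 1 isT) (@phi_Y_neq0 1 isT))).
rewrite phi_polyE // /phi_num /phi_X /phi_Y !big_ord_recl !big_ord0 big1.
  by ring.
by move=> j; rewrite (ord1 j).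
Qed.

Lemma phi2 x1 y1 x2 y2 : phi [:: (x1, y1); (x2, y2)] = x1 * y2 + x2 * y1.
Proof.
rewrite /phi /= (_ : phi_poly 2 =
  phi_x R ord0 * phi_y R (lift ord0 ord0) + phi_x R (lift ord0 ord0) * phi_y R ord0).
  by rewrite mevalD !mevalM !mevalXU !(unsplitK (inl _)) !(unsplitK (inr _)).
apply: (mulfI (mulf_neq0 (@phi_X_neq0 2 isT) (@phi_Y_neq0 2 isT))).
rewrite phi_polyE // /phi_num /phi_X /phi_Y.
rewrite !big_ord_recl !big_ord0 !(big_mkcond (fun j => j != _)) /=.
by rewrite !big_ord_recl !big_ord0 /=; ring.
Qed.

End PhiPoly.

(* Main.v *)
(** The number [XY * phi] is the value at [eps = 1] of the part of degree at most
    [1] in [eps] of the product of the [x_i Y + y_i X - eps x_i y_i], and merging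
    indices changes neither [X] nor [Y].  Expanding the merged factor as a
    quadratic expression in the indicator of [I], the alternating sum over [I]
    collapses to a few products over [S = {2, ..., k}] whose degree [0] and [1]
    coefficients cancel thanks to a Lagrange-type identity (lemma
    [sum_cross_sq]).  To divide by [XY], which may vanish for real arguments, every
    [x_i] and [y_i] is shifted by an indeterminate ['X], evaluated at [0] at the
    end. *)
Require Import Defs.
From mathcomp Require Import all_boot all_order all_algebra.
From mathcomp Require Import reals.
From mathcomp Require Import mpoly ring.

Set Implicit Arguments.
Unset Strict Implicit.
Unset Printing Implicit Defensive.

Import GRing.Theory.
Local Open Scope ring_scope.

(** * Sums over subsets, and low-degree coefficients of products of linear polynomials *)

Section FinsetSums.
Variables (A : comNzRingType) (T : finType).
Implicit Types (S I B : {set T}).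

Lemma sum_offdiag_swap S (F : T -> T -> A) :
  \sum_(i in S) \sum_(j in S :\ i) F i j = \sum_(i in S) \sum_(j in S :\ i) F j i.
Proof.
rewrite (exchange_big_dep (fun j => j \in S)) /= => [|i j _]; last first.
  by rewrite in_setD1 => /andP[].
apply: eq_bigr => i Si; apply: eq_bigl => j.
by rewrite !inE eq_sym Si andbT andbC.
Qed.

(** Distributivity over the whole of [T]: [F] vanishes outside [S] and [G] vanishes on [B], so only
    the sets between [B] and [S] survive, and [G] is 1 outside [S]. *)
Lemma sum_prod_between S B (u v : T -> A) : B \subset S ->
  \sum_(I : {set T} | (B \subset I) && (I \subset S))
     (\prod_(i in I) u i) * \prod_(i in S :\: I) v i =
  (\prod_(i in B) u i) * \prod_(i in S :\: B) (u i + v i).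
Proof.
move=> /subsetP sBS.
pose F i := if i \in S then u i else 0.
pose G i := if i \in B then 0 else if i \in S then v i else 1.
transitivity (\prod_i (F i + G i)); last first.
  rewrite [X in X * _]big_mkcond [X in _ * X]big_mkcond -big_split /=.
  apply: eq_bigr => i _; rewrite /F /G in_setD.
  case: (boolP (i \in B)) => [/sBS->|nBi] /=; first by rewrite mulr1 addr0.
  by case: (i \in S); rewrite ?add0r mul1r.
rewrite bigA_distr /= big_mkcond; apply: eq_bigr => I _.
case: ifPn => [/andP[/subsetP sBI /subsetP sIS]|].
  rewrite [X in X * _]big_mkcond [X in _ * X]big_mkcond -big_split /=.
  apply: eq_bigr => i _; rewrite /F /G in_setD.
  case: (boolP (i \in I)) => [/sIS ->|/= nIi]; first by rewrite mulr1.
  by rewrite (negPf (contraNN (@sBI i) nIi)) mul1r.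
rewrite negb_and => /orP[] /subsetPn[i i1 i2]; rewrite (bigD1 i) //=.
  by rewrite (negPf i2) /G i1 mul0r.
by rewrite i1 /F (negPf i2) mul0r.
Qed.

Lemma sum_prod_subsets S (u v : T -> A) :
  \sum_(I : {set T} | I \subset S)
     (\prod_(i in I) u i) * \prod_(i in S :\: I) v i =
  \prod_(i in S) (u i + v i).
Proof.
have := sum_prod_between u v (sub0set S); rewrite big_set0 mul1r setD0 => <-.
by apply: eq_bigl => I; rewrite sub0set.
Qed.

(** After exchanging the sums, the sets containing a fixed [i] are those between [[set i]] and [S];
    [sum_prod_subsets2] does the same with pairs. *)
Lemma sum_prod_subsets1 S (u v w : T -> A) :
  \sum_(I : {set T} | I \subset S)
     (\prod_(i in I) u i) * (\prod_(i in S :\: I) v i) * \sum_(i in I) w i =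
  \sum_(i in S) w i * u i * \prod_(j in S :\ i) (u j + v j).
Proof.
under eq_bigr => I _ do rewrite mulr_sumr.
rewrite (exchange_big_dep (fun i => i \in S)) /= => [|I i /subsetP]; last exact.
apply: eq_bigr => i Si.
rewrite -mulrA -[u i](big_set1 *%R) -sum_prod_between ?sub1set // mulr_sumr.
by apply: eq_big => [I|I _]; rewrite ?sub1set 1?andbC // mulrC.
Qed.

Lemma sum_prod_subsets2 S (u v : T -> A) (w : T -> T -> A) :
  \sum_(I : {set T} | I \subset S)
     (\prod_(i in I) u i) * (\prod_(i in S :\: I) v i)
       * \sum_(i in I) \sum_(j in I :\ i) w i j =
  \sum_(i in S) \sum_(j in S :\ i)
     w i j * u i * u j * \prod_(l in S :\ i :\ j) (u l + v l).
Proof.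
under eq_bigr => I _ do rewrite mulr_sumr.
rewrite (exchange_big_dep (fun i => i \in S)) /= => [|I i /subsetP]; last exact.
apply: eq_bigr => i Si.
under eq_bigr => I _ do rewrite mulr_sumr.
rewrite (exchange_big_dep (fun j => j \in S :\ i)) /= => [|I j /andP[sIS _]].
  apply: eq_bigr => j; rewrite in_setD1 => /andP[ji Sj].
  have -> : S :\ i :\ j = S :\: [set i; j] by rewrite setDDl.
  have -> : w i j * u i * u j = w i j * \prod_(l in [set i; j]) u l.
    by rewrite big_setU1 ?inE 1?eq_sym //= big_set1 mulrA.
  rewrite -mulrA -sum_prod_between ?subUset ?sub1set ?Si // mulr_sumr.
  apply: eq_big => [I|I _]; last by rewrite mulrC.
  by rewrite subUset !sub1set in_setD1 ji /= [RHS]andbC andbA.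
by rewrite !in_setD1 => /andP[->] /(subsetP sIS).
Qed.

Lemma coef0_prod_linear S (a c : T -> A) :
  (\prod_(i in S) ((a i)%:P - (c i)%:P * 'X))`_0 = \prod_(i in S) a i.
Proof.
by rewrite coef0_prod; apply: eq_bigr => i _; rewrite coefB coefMX coefC subr0.
Qed.

(** With [a i = x i * Y + y i * X] and [c i = x i * y i], this coefficient and the one of degree 0
    add up to the numerator of [phi]. *)
Lemma coef1_prod_linear S (a c : T -> A) :
  (\prod_(i in S) ((a i)%:P - (c i)%:P * 'X))`_1 =
  - \sum_(i in S) c i * \prod_(j in S :\ i) a j.
Proof.
elim: {S}#|S| {-2}S (erefl #|S|) => [|n IHn] S.
  by move/eqP; rewrite cards_eq0 => /eqP->; rewrite !big_set0 coef1 oppr0.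
move=> cardS; have [i Si] : exists i, i \in S.
  by apply/set0Pn; rewrite -card_gt0 cardS.
rewrite !(big_setD1 i Si) /= mulrBl -mulrA coefB !coefCM ['X * _]mulrC coefMX /=.
rewrite coef0_prod_linear IHn; last first.
  by apply/eqP; rewrite -eqSS -cardS [#|S|](cardsD1 i) Si.
rewrite mulrN mulr_sumr opprD addrC; congr (_ - _).
apply: eq_bigr => j /setD1P[ji Sj].
rewrite [X in _ = _ * X](big_setD1 i) ?in_setD1 1?eq_sym ?ji //= mulrCA.
by congr (_ * (_ * _)); apply: eq_bigl => l; rewrite !inE andbCA.
Qed.

End FinsetSums.

Lemma sum_setD1 (V : zmodType) (T : finType) (S : {set T}) (F : T -> V) i :
  i \in S -> \sum_(j in S :\ i) F j = \sum_(j in S) F j - F i.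
Proof. by move=> Si; rewrite [in RHS](big_setD1 i Si) /= [F i + _]addrC addrK. Qed.

(** * The alternating sum of the merged numerators vanishes *)

Section NumeratorIdentity.
Variables (A : idomainType) (T : finType) (S : {set T}) (x y : T -> A).

Let X' := \sum_(i in S) x i.
Let Y' := \sum_(i in S) y i.
Hypotheses (X'_neq0 : X' != 0) (Y'_neq0 : Y' != 0) (two_neq0 : 2%:R != 0 :> A).

Let g i := x i * Y' + y i * X'.

Lemma sum_cross_sq :
  \sum_(i in S) \sum_(j in S :\ i)
     (x i * y j - x j * y i) ^+ 2 * \prod_(l in S :\ i :\ j) g l =
  2%:R * (\prod_(i in S) g i
          - 2%:R * \sum_(i in S) x i * y i * \prod_(j in S :\ i) g j).
Proof.
(* X' (x_i y_j - x_j y_i) = x_i g_j - x_j g_i, and similarly with Y', so after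
   multiplication by X' Y' each summand is expressible with G alone. *)
apply: (mulfI (mulf_neq0 X'_neq0 Y'_neq0)).
set P := \prod_(i in S) g i; pose G i := \prod_(j in S :\ i) g j.
have PE i : i \in S -> P = g i * G i by move=> Si; rewrite /P (big_setD1 i).
(* The product [(x i * g j - x j * g i) * (y j * g i - y i * g j)] has four terms; two of them give
   [F i j], the other two [F j i]. *)
pose F i j := x i * y j * P - x i * y i * (g j * G i).
transitivity (\sum_(i in S) \sum_(j in S :\ i) (F i j + F j i)).
  rewrite mulr_sumr; apply: eq_bigr => i Si; rewrite mulr_sumr.
  apply: eq_bigr => j Sj'; have /setD1P[ji Sj] := Sj'.
  have Sij : i \in S :\ j by rewrite !inE eq_sym ji.
  rewrite /F (PE i Si) /G (big_setD1 j Sj') (big_setD1 i Sij) /=.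
  have -> : S :\ j :\ i = S :\ i :\ j by rewrite !setDDl setUC.
  by rewrite /g; ring.
under eq_bigr => i _ do rewrite big_split /=.
rewrite big_split /= -(sum_offdiag_swap S F).
have sumg : \sum_(i in S) g i = 2%:R * (X' * Y').
  by rewrite /g big_split /= -!mulr_suml -/X' -/Y'; ring.
(* In the sum of [F i j] over [j != i], the two diagonal corrections cancel because
   [P = g i * G i]. *)
transitivity (2%:R * \sum_(i in S)
    (P * Y' * x i - 2%:R * (X' * Y') * (x i * y i * G i))).
  rewrite mulr_natl mulr2n; congr (_ + _); apply: eq_bigr => i Si;
    rewrite /F sumrB -mulr_suml -!mulr_sumr -mulr_suml !sum_setD1 //;
    by rewrite sumg -/Y' (PE i Si); ring.
by rewrite sumrB -!mulr_sumr -/X'; ring.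
Qed.

Variables x1 y1 : A.
Let X := x1 + X'.
Let Y := y1 + Y'.
Let b i := x1 * y i + x i * y1.

(** The term [I = set0] carries the numerator of the unmerged [phi], the others those of the
    right-hand side with opposite sign: this is the theorem multiplied by [X * Y]. *)
Lemma sum_merged_linear :
  let p := \sum_(I : {set T} | I \subset S)
    (\prod_(i in I) - (b i)%:P)
    * (\prod_(i in S :\: I)
         ((x i * Y + y i * X)%:P - (x i * y i)%:P * 'X))
    * (((x1 + \sum_(i in I) x i) * Y + (y1 + \sum_(i in I) y i) * X)%:P
       - ((x1 + \sum_(i in I) x i) * (y1 + \sum_(i in I) y i))%:P * 'X) in
  p`_0 + p`_1 = 0.
Proof.
move=> p; pose d i : {poly A} := (x i * Y + y i * X)%:P - (x i * y i)%:P * 'X.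
pose u i : {poly A} := - (b i)%:P.
(* Subtracting [b i] replaces the totals [X], [Y] by [X'], [Y'], which removes [x1] and [y1] from
   the factor. *)
pose e i : {poly A} := (g i)%:P - (x i * y i)%:P * 'X.
have ude i : u i + d i = e i.
  by rewrite /u /d /e /g /b /X /Y addrA -polyCN -polyCD; congr (_%:P - _); ring.
(* [w i] is what a single index [i] adds to the merged factor; only products [x i * y j] with
   [i != j] remain beside these. *)
pose w i : {poly A} := (x i * Y + y i * X)%:P - (x i * y i + b i)%:P * 'X.
have we i : w i = e i + (b i)%:P * (1 - 'X).
  rewrite /w /e (_ : x i * Y + y i * X = g i + b i).
    by rewrite !polyCD; ring.
  by rewrite /g /b /X /Y; ring.
pose D : {poly A} := (x1 * Y + y1 * X)%:P - (x1 * y1)%:P * 'X.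
have mergedE (I : {set T}) :
    ((x1 + \sum_(i in I) x i) * Y + (y1 + \sum_(i in I) y i) * X)%:P
       - ((x1 + \sum_(i in I) x i) * (y1 + \sum_(i in I) y i))%:P * 'X =
    D + \sum_(i in I) w i - 'X * \sum_(i in I) \sum_(j in I :\ i) (x i * y j)%:P.
  pose sx := \sum_(i in I) x i; pose sy := \sum_(i in I) y i.
  have -> : \sum_(i in I) \sum_(j in I :\ i) (x i * y j)%:P =
      (sx * sy - \sum_(i in I) x i * y i)%:P.
    rewrite [in RHS]/sx mulr_suml -sumrB rmorph_sum; apply: eq_bigr => i Ii /=.
    by rewrite -rmorph_sum -mulr_sumr sum_setD1 // mulrBr.
  have -> : \sum_(i in I) w i = (sx * Y + sy * X)%:P
      - (\sum_(i in I) x i * y i + (x1 * sy + sx * y1))%:P * 'X.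
    rewrite /w sumrB -mulr_suml -!rmorph_sum /= !big_split /= /b.
    by rewrite -!mulr_suml -mulr_sumr.
  rewrite -/sx -/sy /D !(polyCD, polyCM, polyCN, polyCB); ring.
pose E := \prod_(i in S) e i.
pose E1 i := \prod_(j in S :\ i) e j.
pose E2 i j := \prod_(l in S :\ i :\ j) e l.
have pE : p = D * E - \sum_(i in S) (b i)%:P * (E + (b i)%:P * (E1 i - E1 i * 'X))
    - \sum_(i in S) \sum_(j in S :\ i) (x i * y j * b i * b j)%:P * (E2 i j * 'X).
  transitivity (\sum_(I : {set T} | I \subset S)
      (D * ((\prod_(i in I) u i) * \prod_(i in S :\: I) d i)
       + (\prod_(i in I) u i) * (\prod_(i in S :\: I) d i) * \sum_(i in I) w i
       - 'X * ((\prod_(i in I) u i) * (\prod_(i in S :\: I) d i)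
         * \sum_(i in I) \sum_(j in I :\ i) (x i * y j)%:P))).
    by apply: eq_bigr => I _; rewrite mergedE; ring.
  rewrite sumrB big_split /= -!mulr_sumr sum_prod_subsets sum_prod_subsets1.
  rewrite sum_prod_subsets2; congr (_ + _ - _).
  - by congr (_ * _); apply: eq_bigr.
  - rewrite -sumrN; apply: eq_bigr => i Si; rewrite (eq_bigr e) // -/(E1 i) we.
    by rewrite /E (big_setD1 i) //= -/(E1 i) /u; ring.
  rewrite mulr_sumr; apply: eq_bigr => i Si; rewrite mulr_sumr.
  apply: eq_bigr => j Sj; rewrite (eq_bigr e) // -/(E2 i j) /u !polyCM; ring.
(* [P], [G1] and [G2] are the constant coefficients of [E], [E1] and [E2]; [Q] is the degree 1
   coefficient of [E]. *)
pose G1 i := \prod_(j in S :\ i) g j.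
pose G2 i j := \prod_(l in S :\ i :\ j) g l.
pose P := \prod_(i in S) g i.
pose Q := - \sum_(i in S) x i * y i * G1 i.
have p0E : p`_0 = (x1 * Y + y1 * X) * P - \sum_(i in S) b i * (P + b i * G1 i).
  rewrite pE !coefB coef0M /D coefB coefMX coefC subr0 coef0_prod_linear -/P.
  rewrite !coef_sum [X in _ - _ - X]big1 ?subr0 => [|i _]; last first.
    by rewrite coef_sum big1 // => j _; rewrite coefCM coefMX mulr0.
  congr (_ - _); apply: eq_bigr => i _.
  by rewrite coefCM coefD coefCM coefB coefMX subr0 !coef0_prod_linear.
have p1E : p`_1 = (x1 * Y + y1 * X) * Q - x1 * y1 * P
    - \sum_(i in S) b i * (Q - b i * (\sum_(j in S :\ i) x j * y j * G2 i j + G1 i))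
    - \sum_(i in S) \sum_(j in S :\ i) x i * y j * b i * b j * G2 i j.
  rewrite pE !coefB; congr (_ - _ - _).
  - rewrite /D mulrBl coefB coefCM coef1_prod_linear -(mulrA _ 'X) coefCM.
    by rewrite ['X * _]mulrC coefMX /= coef0_prod_linear.
  - rewrite coef_sum; apply: eq_bigr => i _.
    rewrite coefCM coefD coefCM coefB coefMX /= !coef1_prod_linear coef0_prod_linear.
    by rewrite -/(G1 i) -/Q; ring.
  rewrite coef_sum; apply: eq_bigr => i _.
  rewrite coef_sum; apply: eq_bigr => j _.
  by rewrite coefCM coefMX /= coef0_prod_linear.
have sumb : \sum_(i in S) b i = x1 * Y' + y1 * X'.
  by rewrite big_split /= -mulr_sumr -mulr_suml -/X' -/Y' [y1 * _]mulrC.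
pose H i j := (b i * b i * (x j * y j) - x i * y j * b i * b j) * G2 i j.
(* Since [x1 * Y + y1 * X] is [2 * x1 * y1] plus the sum of the [b i], all terms linear in [b]
   cancel, and so do the terms [b i * b i * G1 i]. *)
have -> : p`_0 + p`_1 = x1 * y1 * (P + 2%:R * Q)
    + \sum_(i in S) \sum_(j in S :\ i) H i j.
  have -> : \sum_(i in S) \sum_(j in S :\ i) H i j =
     \sum_(i in S) b i * b i * (\sum_(j in S :\ i) x j * y j * G2 i j)
     - \sum_(i in S) \sum_(j in S :\ i) x i * y j * b i * b j * G2 i j.
    rewrite -sumrB; apply: eq_bigr => i _; rewrite mulr_sumr -sumrB.
    by apply: eq_bigr => j _; rewrite /H; ring.
  set K := \sum_(i in S) \sum_(j in S :\ i) _ * G2 i j.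
  have -> : \sum_(i in S) b i * b i * (\sum_(j in S :\ i) x j * y j * G2 i j) =
      (x1 * Y' + y1 * X') * (P + Q)
      - \sum_(i in S) b i * (P + b i * G1 i)
      - \sum_(i in S) b i * (Q - b i * (\sum_(j in S :\ i) x j * y j * G2 i j + G1 i)).
    rewrite -sumb mulr_suml -!sumrB; apply: eq_bigr => i _; ring.
  by rewrite p0E p1E -/K /X /Y; ring.
(* Doubling allows symmetrization: [H i j + H j i] is [(b i * x j - b j * x i) * (b i * y j - b j *
   y i) * G2 i j], that is, [- x1 * y1 * (x i * y j - x j * y i) ^+ 2 * G2 i j], the opposite of the
   summand from [sum_cross_sq]. *)
apply: (mulfI two_neq0); rewrite mulr0 mulrDr.
have -> : 2%:R * (x1 * y1 * (P + 2%:R * Q)) = \sum_(i in S) \sum_(j in S :\ i)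
   x1 * y1 * ((x i * y j - x j * y i) ^+ 2 * G2 i j).
  under [RHS]eq_bigr => i _ do rewrite -mulr_sumr.
  by rewrite -mulr_sumr sum_cross_sq /Q /G1 /P; ring.
rewrite mulr_natl mulr2n [X in _ + (_ + X)]sum_offdiag_swap -!big_split /=.
apply: big1 => i _; rewrite -!big_split /=; apply: big1 => j _.
have -> : H j i = (b j * b j * (x i * y i) - x j * y i * b j * b i) * G2 i j.
  by rewrite /H /G2 (_ : S :\ j :\ i = S :\ i :\ j) // !setDDl setUC.
by rewrite /H /b; ring.
Qed.
End NumeratorIdentity.

(** * Evaluation of [phi] at polynomial arguments *)

Section PhiLift.
Variable R : realType.
Implicit Type s : seq ({poly R} * {poly R}).

Let args (B : Type) (b0 : B) l (s : seq (B * B)) (i : 'I_(l + l)) : B :=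
  match split i with
  | inl j => (nth (b0, b0) s j).1
  | inr j => (nth (b0, b0) s j).2
  end.

Definition phi_lift s : {poly R} := mmap polyC (args 0 s) (phi_poly R (size s)).

Lemma horner_phi_lift s a :
  (phi_lift s).[a] = phi [seq (p.1.[a], p.2.[a]) | p <- s].
Proof.
(* The type of [phi_poly] depends on the length, and mapping preserves [size] only propositionally;
   a free [l] makes the substitution possible. *)
have phiE l (t : seq (R * R)) : size t = l -> phi t = (phi_poly R l).@[args 0 t].
  move=> <-; apply: meval_eq => i; rewrite /args.
  by case: (split i) => j; rewrite (tnth_nth (0, 0)).
rewrite (phiE (size s)) ?size_map // /phi_lift /meval /mmap horner_sum.
apply: eq_bigr => m _; rewrite hornerM hornerC /mmap1 horner_prod; congr (_ * _).
apply: eq_bigr => i _; rewrite horner_exp /args; congr (_ ^+ _).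
by case: (split i) => j; rewrite (nth_map (0, 0)).
Qed.

(** The image of [phi_polyE] under the substitution morphism. In [q] the outer ['X] is [eps],
    distinct from the indeterminate of the entries of [s]. *)
Lemma phi_liftE s (X := \sum_(p <- s) p.1) (Y := \sum_(p <- s) p.2)
    (q := \prod_(p <- s) ((p.1 * Y + p.2 * X)%:P - (p.1 * p.2)%:P * 'X)) :
  (0 < size s)%N -> X * Y * phi_lift s = q`_0 + q`_1.
Proof.
move=> s_gt0; have := congr1 (mmap polyC (args 0 s)) (phi_polyE R s_gt0).
rewrite rmorphM rmorphM -/(phi_lift s) /phi_num.
have xE (i : 'I_(size s)) : mmap polyC (args 0 s) (phi_x R i) = (nth (0, 0) s i).1.
  by rewrite mmapX mmap1U /args (unsplitK (inl i)).
have yE (i : 'I_(size s)) : mmap polyC (args 0 s) (phi_y R i) = (nth (0, 0) s i).2.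
  by rewrite mmapX mmap1U /args (unsplitK (inr i)).
have XE : mmap polyC (args 0 s) (phi_X R (size s)) = X.
  rewrite /phi_X rmorph_sum /X (big_nth (0, 0)) big_mkord.
  by apply: eq_bigr => i _; apply: xE.
have YE : mmap polyC (args 0 s) (phi_Y R (size s)) = Y.
  rewrite /phi_Y rmorph_sum /Y (big_nth (0, 0)) big_mkord.
  by apply: eq_bigr => i _; apply: yE.
have aE (i : 'I_(size s)) : mmap polyC (args 0 s)
    (phi_x R i * phi_Y R (size s) + phi_y R i * phi_X R (size s)) =
    (nth (0, 0) s i).1 * Y + (nth (0, 0) s i).2 * X.
  by rewrite rmorphD !rmorphM /= xE yE XE YE.
rewrite /= XE YE => ->; rewrite rmorphB rmorph_prod rmorph_sum /= /q.
rewrite (big_nth (0, 0)) big_mkord.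
rewrite [in RHS](eq_bigl (fun i => i \in [set: 'I_(size s)])) => [|i]; last first.
  by rewrite in_setT.
rewrite coef0_prod_linear coef1_prod_linear; congr (_ - _).
  by apply: eq_big => i; rewrite ?in_setT // => _; apply: aE.
apply: eq_big => i; first by rewrite in_setT.
move=> _; rewrite !rmorphM rmorph_prod /= xE yE; congr (_ * _).
by apply: eq_big => j; rewrite ?in_setD1 ?in_setT ?andbT // => _; apply: aE.
Qed.

End PhiLift.

(** * Transfer to real arguments by shifting, cancelling and evaluating at 0 *)

Lemma enum_ord_setC1 n (o : 'I_n) : o = 0 :> nat -> enum 'I_n = o :: enum [set~ o].
Proof.
case: n o => [[]//|n] o o0; have -> : o = ord0 by apply: val_inj.
have -> : enum [set~ ord0] = filter (mem [set~ ord0]) (enum 'I_n.+1).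
  by rewrite [in RHS]enumT.
rewrite enum_ordSl /= in_setC1 eqxx /=; congr (_ :: _); apply/esym/all_filterP.
by apply/allP => _ /mapP[i _ ->]; rewrite inE in_setC1.
Qed.

Theorem theorem3p1 (R : realType) (k : nat) (hk : (2 <= k)%N)
    (x y : 'I_k -> R) :
  let o : 'I_k := Ordinal (ltnW hk) in
  phi [seq (x i, y i) | i <- enum 'I_k] =
  \sum_(I : {set 'I_k} | (I != set0) && (I \subset [set~ o]))
    (-1) ^+ (#|I| - 1) * (\prod_(j in I) (x o * y j + x j * y o))
    * phi ((x o + \sum_(i in I) x i, y o + \sum_(i in I) y i)
           :: [seq (x i, y i) | i <- enum ([set~ o] :\: I)]).
Proof.
move=> o; pose S := [set~ o].
pose xt i : {poly R} := (x i)%:P + 'X; pose yt i : {poly R} := (y i)%:P + 'X.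
(* The degree 1 coefficient is [#|B|], nonzero in characteristic 0. *)
have sum_shift_neq0 (B : {set 'I_k}) (z : 'I_k -> R) :
    (0 < #|B|)%N -> \sum_(i in B) ((z i)%:P + 'X) != 0 :> {poly R}.
  move=> B_gt0; apply: contraTneq (oner_neq0 R).
  move=> /(congr1 (fun p : {poly R} => p`_1)).
  rewrite big_split /= sumr_const -rmorph_sum coefD coefC coefMn coefX coef0 add0r /=.
  by move/eqP; rewrite Num.Theory.pnatr_eq0 -leqn0 leqNgt B_gt0.
have cardS : (0 < #|S|)%N by rewrite cardsC1 card_ord -subn1 subn_gt0.
pose X := \sum_(i in S) xt i; pose Y := \sum_(i in S) yt i.
pose merged (I : {set 'I_k}) :=
  (xt o + \sum_(i in I) xt i, yt o + \sum_(i in I) yt i)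
   :: [seq (xt i, yt i) | i <- enum (S :\: I)].
pose b j := xt o * yt j + xt j * yt o.
have XYneq0 : (xt o + X) * (yt o + Y) != 0.
  have oS : o \notin S by rewrite !inE eqxx.
  by rewrite mulf_neq0 // -big_setU1 //= sum_shift_neq0 // cardsU1 oS.
have sum_merged (I : {set 'I_k}) (z : 'I_k -> {poly R}) : I \subset S ->
    z o + \sum_(i in I) z i + \sum_(i <- enum (S :\: I)) z i = z o + \sum_(i in S) z i.
  move=> sIS; rewrite -addrA; congr (_ + _).
  by rewrite big_enum [RHS](big_setID I) /= (setIidPr sIS).
(* All merged lists share the same totals by [sum_merged], so one nonzero factor clears every
   denominator. *)
have key : \sum_(I : {set 'I_k} | I \subset S)
    (\prod_(i in I) - b i) * phi_lift (merged I) = 0.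
  apply: (mulfI XYneq0); rewrite mulr0 mulr_sumr.
  rewrite -[RHS](@sum_merged_linear _ _ S xt yt _ _ _ (xt o) (yt o)) ?sum_shift_neq0 //.
    rewrite !coef_sum -big_split /=; apply: eq_bigr => I sIS.
    rewrite mulrCA.
    have := @phi_liftE R (merged I) isT.
    rewrite !big_cons !big_map /= !sum_merged // -/X -/Y => ->.
    have -> : \prod_(i in I) (- (b i)%:P) = (\prod_(i in I) - b i)%:P.
      by rewrite rmorph_prod; apply: eq_bigr => i _; rewrite /= polyCN.
    by rewrite -!mulrA !coefCM -mulrDr big_enum /= ![_ * \prod_(i in _) _]mulrC.
  by rewrite -polyCMn polyC_eq0 Num.Theory.pnatr_eq0.
have evx i : (xt i).[0] = x i by rewrite hornerD hornerC hornerX addr0.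
have evy i : (yt i).[0] = y i by rewrite hornerD hornerC hornerX addr0.
(* Otherwise [hornerD] would also split the shifted variables. *)
clearbody xt yt.
have ev_merged (I : {set 'I_k}) : (phi_lift (merged I)).[0] =
    phi ((x o + \sum_(i in I) x i, y o + \sum_(i in I) y i)
         :: [seq (x i, y i) | i <- enum (S :\: I)]).
  rewrite horner_phi_lift /= !hornerD !horner_sum evx evy -map_comp.
  congr (phi ((_ + _, _ + _) :: _)); try by apply: eq_bigr => i _; rewrite ?evx ?evy.
  by apply: eq_map => i /=; rewrite evx evy.
have := congr1 (horner^~ 0) key.
(* The term of the empty set is [phi] of the original list, [o] being the first index; moving the
   other terms across accounts for the exponent [#|I| - 1]. *)
rewrite horner_sum horner0 (bigD1 set0) ?sub0set //= big_set0 mul1r ev_merged.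
rewrite !big_set0 !addr0 setD0 => /eqP; rewrite addr_eq0 -sumrN => /eqP.
rewrite [enum 'I_k](@enum_ord_setC1 _ o) //= => ->.
apply: eq_big => [I|I /andP[_ I0]]; first by rewrite andbC.
rewrite hornerM ev_merged -mulNr horner_prod; congr (_ * _).
have -> : \prod_(i in I) (- b i).[0] =
    (-1) ^+ #|I| * \prod_(j in I) (x o * y j + x j * y o).
  rewrite -prodr_const -big_split /=; apply: eq_bigr => i _.
  by rewrite hornerN hornerD !hornerM !evx !evy mulN1r.
rewrite -mulNr; congr (_ * _).
have: (0 < #|I|)%N by rewrite card_gt0.
by case: #|I| => // n _; rewrite subn1 exprS mulN1r opprK.
Qed.
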